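(* Let $X$ be an infinite set. (i) $\operatorname{rank}(\mathcal F_X:\mathcal E_X)=2^{|X|}$. (ii) If $\Omega\subseteq\mathcal F_X$, then $\mathcal F_X=\langle\mathcal E_X\cup\Omega\rangle$ if and only if $\mathcal G_X=\langle\mathcal G_X\cap\Omega\rangle$.
   Context: Partial Brauer monoid. Let $X$ be a set and $X'=\{x':x\in X\}$ a disjoint copy of $X$. A Brauer graph is an (undirected) graph with vertex set $X\cup X'$ in which every vertex has degree at most $1$; $\mathcal{PB}_X$ is the set of all of them. Product: let $X''=\{x'':x\in X\}$ be another disjoint copy of $X$; given $\alpha,\beta\in\mathcal{PB}_X$, let $\alpha^\vee$ be $\alpha$ with each vertex $x'$ renamed $x''$, let $\beta^\wedge$ be $\beta$ with each vertex $x\in X$ renamed $x''$, and let $\Pi(\alpha,\beta)$ be the graph on $X\cup X'\cup X''$ with all edges of $\alpha^\vee$ and $\beta^\wedge$. Then $\alpha\beta$ is the graph on $X\cup X'$ with an edge $\{x,y\}$ whenever $x,y\in X\cup X'$ are distinct and lie in the same connected component of $\Pi(\alpha,\beta)$. This makes $\mathcal{PB}_X$ a monoid with identity the graph with edge set $\{\{x,x'\}:x\in X\}$. $\mathcal G_X$ denotes the group of (two-sided) units of $\mathcal{PB}_X$; $\mathcal E_X$ denotes the subsemigroup of $\mathcal{PB}_X$ generated by all its idempotents; $\mathcal F_X$ denotes the subsemigroup generated by all idempotents together with $\mathcal G_X$. For a subset $U$ of a semigroup $S$, $\langle U\rangle$ is the subsemigroup generated by $U$. For $A\subseteq S$, the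 relative rank is $\operatorname{rank}(S:A)=\min\{|U| : U\subseteq S,\ S=\langle A\cup U\rangle\}$. *)

(* Defs.v *)
From HB Require Import structures.
From Stdlib Require Import Relation_Operators Operators_Properties.
From mathcomp Require Import all_boot.
From mathcomp Require Import boolp classical_sets functions cardinality.

Set Implicit Arguments.
Unset Strict Implicit.
Unset Printing Implicit Defensive.

Local Open Scope classical_set_scope.
Local Open Scope card_scope.
Local Open Scope group_scope.

Definition connected V (E : V -> V -> Prop) : V -> V -> Prop :=
  clos_refl_sym_trans V E.

Definition relabel V W (f : V -> W) (E : V -> V -> Prop) : W -> W -> Prop :=
  fun u v => exists s t, [/\ E s t, u = f s & v = f t].

Definition edgeU V (E F : V -> V -> Prop) : V -> V -> Prop :=
  fun u v => E u v \/ F u v.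

Section Connectivity.
Variables V W : Type.
Implicit Types (E F G : V -> V -> Prop).

Lemma connected_mono E F :
  (forall u v, E u v -> connected F u v) ->
  forall u v, connected E u v -> connected F u v.
Proof.
move=> EF u v; elim=> [x y /EF //|x|x y _ IH|x y z _ IH1 _ IH2].
- exact: rst_refl.
- exact: rst_sym.
- exact: rst_trans IH1 IH2.
Qed.

Lemma relabelU (f : V -> W) E F :
  relabel f (edgeU E F) = edgeU (relabel f E) (relabel f F).
Proof.
apply/funext => u; apply/funext => v; apply/propext; split.
- by case=> s [t [[]H -> ->]]; [left|right]; exists s, t.
- by case=> -[s [t [H -> ->]]]; exists s, t; split=> //; [left|right].
Qed.

Lemma connected_relabel (f : V -> W) E : injective f -> forall u v,
  connected (relabel f E) u v <->
  u = v \/ exists s t, [/\ connected E s t, u = f s & v = f t].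
Proof.
move=> finj u v; split.
- elim=> {u v} [u v [s [t [H -> ->]]]|u|u v _ IH|u v w _ IH1 _ IH2].
  + by right; exists s, t; split=> //; apply: rst_step.
  + by left.
  + case: IH => [->|[s [t [H -> ->]]]]; first by left.
    by right; exists t, s; split=> //; apply: rst_sym.
  + case: IH1 => [->//|[s [t [H us vt]]]].
    case: IH2 => [<-|[s' [t' [H' vs wt]]]]; first by right; exists s, t.
    right; exists s, t'; split=> //.
    have e : t = s' by apply: finj; rewrite -vt.
    by apply: rst_trans H _; rewrite e.
- case=> [->|[s [t [H -> ->]]]]; first exact: rst_refl.
  elim: H => {u v s t} [s t H|s|s t _ IH|s t r _ IH1 _ IH2].
  + by apply: rst_step; exists s, t.
  + exact: rst_refl.
  + exact: rst_sym.
  + exact: rst_trans IH1 IH2.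
Qed.

Lemma connected_relabelE (f : V -> W) E : injective f -> forall s t,
  connected (relabel f E) (f s) (f t) <-> connected E s t.
Proof.
move=> finj s t; split.
- case/(connected_relabel _ finj) => [/finj->|]; first exact: rst_refl.
  by case=> s' [t' [H /finj-> /finj->]].
- by move=> H; apply/(connected_relabel _ finj); right; exists s, t.
Qed.

Definition shortcut (M : V -> Prop) E : V -> V -> Prop :=
  fun u v => [/\ ~ M u, ~ M v, u <> v & connected E u v].

Lemma connected_shortcut (M : V -> Prop) E F :
  (forall u v, F u v -> ~ M u /\ ~ M v) ->
  forall u v, ~ M u -> ~ M v ->
  connected (edgeU (shortcut M E) F) u v <-> connected (edgeU E F) u v.
Proof.
move=> FM u v Mu Mv; split.
  apply: connected_mono => {Mu Mv} x y [[_ _ _]|H].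
  - by apply: connected_mono => a b ?; apply: rst_step; left.
  - by apply: rst_step; right.
have short x w : ~ M x -> ~ M w -> connected E x w ->
    connected (edgeU (shortcut M E) F) x w.
  move=> Mx Mw H; have [->|xw] := pselect (x = w); first exact: rst_refl.
  by apply: rst_step; left.
suff H x z : connected (edgeU E F) x z -> ~ M z ->
    exists w, [/\ ~ M w, connected E x w &
                  connected (edgeU (shortcut M E) F) w z].
  case/H => // w [Mw uw wv]; apply: rst_trans wv; exact: short.
have ulink y z' : edgeU E F y z' \/ edgeU E F z' y ->
    connected E y z' \/ [/\ F y z' \/ F z' y, ~ M y & ~ M z'].
  case=> -[] K; [left|right|left|right].
  - exact: rst_step.
  - by have [] := FM _ _ K; split=> //; left.
  - exact/rst_sym/rst_step.
  - by have [] := FM _ _ K; split=> //; right.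
move/clos_rst_rst1n_iff; elim=> {x z} [x|x y z /ulink xy _ IH] Mz.
  by exists x; split=> //; apply: rst_refl.
have [w [Mw yw wz]] := IH Mz; case: xy => [xy|[xy Mx My]].
  by exists w; split=> //; apply: rst_trans xy yw.
exists x; split=> //; first exact: rst_refl.
apply: rst_trans (rst_trans _ _ _ _ _ (short _ _ My Mw yw) wz).
by case: xy => K; [|apply: rst_sym]; apply: rst_step; right.
Qed.

(* A component of the union of two matchings is a path or a cycle, so a vertex
   missing one of the two matchings is joined to at most one other such vertex *)
Lemma matchings_end (E : bool -> V -> V -> Prop) :
  (forall c u v, E c u v -> E c v u) ->
  (forall c u v w, E c u v -> E c u w -> v = w) ->
  forall x y z, (exists c, forall u, ~ E c x u) ->
    (exists c, forall u, ~ E c y u) -> (exists c, forall u, ~ E c z u) ->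
    x <> y -> x <> z ->
    connected (edgeU (E true) (E false)) x y ->
    connected (edgeU (E true) (E false)) x z -> y = z.
Proof.
move=> Esym Efun x y z [c xc] yend zend xy xz.
pose step (s t : V * bool) := E s.2 s.1 t.1 /\ t.2 = ~~ s.2.
pose walk := clos_refl_trans_n1 _ step (x, ~~ c).
have walk_back s : walk s -> s = (x, ~~ c) \/ exists2 t, walk t & step t s.
  by case=> [|s' s'' st ws]; [left|right; exists s'].
have reach v : connected (edgeU (E true) (E false)) x v -> exists d, walk (v, d).
  move/clos_rst_rstn1_iff; elim=> {v} [|u v uv _ [d wu]].
    by exists (~~ c); apply: rtn1_refl.
  have {uv} [e uv] : exists e, E e u v.
    by case: uv => -[] K; [exists true|exists false|exists true|exists false];
       do ?exact: Esym.
  have [ed|/eqP ed] := pselect (e = d).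
    by exists (~~ d); apply: Relation_Operators.rtn1_trans wu; split=> //=; rewrite -ed.
  case: (walk_back _ wu) => [[ux dc]|[[t d'] wt [/= tu dd]]].
    have ec : e = c by move: ed; rewrite dc; case: (e) (c) => [] [].
    by case: (xc v); rewrite -ux -ec.
  have ed' : e = d' by move: ed; rewrite dd; case: (e) (d') => [] [].
  exists d'; suff <- : t = v by [].
  by apply: Efun uv; rewrite ed'; apply: Esym.
have stop v d : (exists c, forall u, ~ E c v u) -> x <> v -> walk (v, d) ->
    forall t, ~ step (v, d) t.
  move=> [e ve] xv /walk_back[[/esym//]|[[t d'] _ [/= tv dd]]] [w d''] [/= vw _].
  have ed' : e = d.
    have : e != d' by apply/eqP => ed'; apply: (ve t); rewrite ed'; apply: Esym.
    by rewrite dd; case: (e) (d') => [] [].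
  by apply: (ve w); rewrite ed'.
have det s t t' : step s t -> step s t' -> t = t'.
  by case: s t t' => s d [t e] [t' e'] [/= K ->] [/= /(Efun _ _ _ _ K)-> ->].
have linear s : walk s -> forall t, walk t ->
    clos_refl_trans_1n _ step s t \/ clos_refl_trans_1n _ step t s.
  move=> ws t; elim=> [|t' t'' st _ [IH|IH]].
  - by right; apply: clos_rt_rt1n; apply: clos_rtn1_rt.
  - left; apply: clos_rt_rt1n; apply: (@rt_trans _ _ _ t').
      exact: clos_rt1n_rt.
    exact: rt_step.
  - case: IH st => [|s' s'' K L] st.
      by left; apply: Relation_Operators.rt1n_trans st _; apply: rt1n_refl.
    by right; rewrite (det _ _ _ st K).
move=> /reach[d wy] /reach[e wz].
have stuck s t : (forall s', ~ step s s') -> clos_refl_trans_1n _ step s t -> s = t.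
  by move=> ss; case=> // s' t' /ss.
have sy := stop _ _ yend xy wy; have sz := stop _ _ zend xz wz.
by case: (linear _ wy _ wz) => [/(stuck _ _ sy)[]|/(stuck _ _ sz)[]].
Qed.

End Connectivity.

Lemma relabel_comp U V W (f : U -> V) (g : V -> W) (E : U -> U -> Prop) :
  relabel g (relabel f E) = relabel (g \o f) E.
Proof.
apply/funext => u; apply/funext => v; apply/propext; split.
- by case=> _ [_ [[s [t [H -> ->]]] -> ->]]; exists s, t.
- by case=> s [t [H -> ->]]; exists (f s), (f t); split=> //; exists s, t.
Qed.

(* Vertices: [inl x] is x in the upper copy X, [inr x] is x' in X' *)
Record PB (X : Type) := BrauerGraph {
  edge : X + X -> X + X -> Prop;
  edge_sym : forall u v, edge u v -> edge v u;
  edge_irrefl : forall u, ~ edge u u;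
  edge_deg1 : forall u v w, edge u v -> edge u w -> v = w }.

Lemma PB_eq (X : Type) (a b : PB X) :
  (forall u v, edge a u v <-> edge b u v) -> a = b.
Proof.
move=> ab; have : edge a = edge b.
  by apply/funext => u; apply/funext => v; apply/propext.
case: a b {ab} => [e s i d] [e' s' i' d'] /= ee'; rewrite -ee' in s' i' d' *.
by congr BrauerGraph; apply: Prop_irrelevance.
Qed.

HB.instance Definition _ (X : Type) := gen_eqMixin (PB X).
HB.instance Definition _ (X : Type) := gen_choiceMixin (PB X).

Section Product.
Variable X : Type.
Implicit Types a b c : PB X.

(* Vertices of the product graph: [inl v] is v in X or X', [inr x] is x'' *)
Definition lower_to_mid (v : X + X) : (X + X) + X :=
  match v with inl x => inl (inl x) | inr x => inr x end.

Definition upper_to_mid (v : X + X) : (X + X) + X :=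
  match v with inl x => inr x | inr x => inl (inr x) end.

Definition product_graph a b : (X + X) + X -> (X + X) + X -> Prop :=
  edgeU (relabel lower_to_mid (edge a)) (relabel upper_to_mid (edge b)).

Definition mul_edge a b (u v : X + X) : Prop :=
  u <> v /\ connected (product_graph a b) (inl u) (inl v).

Lemma mul_edge_sym a b u v : mul_edge a b u v -> mul_edge a b v u.
Proof. by case=> uv H; split; [move/esym|apply: rst_sym]. Qed.

Lemma mul_edge_irrefl a b u : ~ mul_edge a b u u.
Proof. by case. Qed.

Lemma relabel_sym V W (f : V -> W) (E : V -> V -> Prop) :
  (forall u v, E u v -> E v u) ->
  forall u v, relabel f E u v -> relabel f E v u.
Proof. by move=> Esym u v [s [t [/Esym H -> ->]]]; exists t, s. Qed.

Lemma relabel_deg1 V W (f : V -> W) (E : V -> V -> Prop) : injective f ->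
  (forall u v w, E u v -> E u w -> v = w) ->
  forall u v w, relabel f E u v -> relabel f E u w -> v = w.
Proof.
move=> finj Efun u v w [s [t [H -> ->]]] [s' [t' [H' /finj ss ->]]].
by rewrite -ss in H'; rewrite (Efun _ _ _ H H').
Qed.

Lemma lower_to_mid_inj : injective lower_to_mid.
Proof. by move=> [x|x] [y|y] //= []->. Qed.

Lemma upper_to_mid_inj : injective upper_to_mid.
Proof. by move=> [x|x] [y|y] //= []->. Qed.

Lemma mul_edge_deg1 a b u v w : mul_edge a b u v -> mul_edge a b u w -> v = w.
Proof.
move=> [uv cuv] [uw cuw].
have inlI : injective (@inl (X + X) X) by move=> ? ? [].
pose E (d : bool) := if d
  then relabel lower_to_mid (edge a) else relabel upper_to_mid (edge b).
have outer (s : X + X) : exists d, forall t, ~ E d (inl s) t.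
  by case: s => x; [exists false|exists true] => t [[y|y] [? []]].
have neq s : u <> s -> @inl (X + X) X u <> inl s by move=> us /inlI.
apply: inlI; apply: (@matchings_end _ E) (neq _ uv) (neq _ uw) cuv cuw => //.
- by case=> s t; apply: relabel_sym; apply: edge_sym.
- case=> s t r; apply: relabel_deg1; try exact: edge_deg1.
    exact: lower_to_mid_inj.
  exact: upper_to_mid_inj.
Qed.

Definition mulPB a b : PB X :=
  BrauerGraph (@mul_edge_sym a b) (@mul_edge_irrefl a b) (@mul_edge_deg1 a b).

Definition one_edge (u v : X + X) : Prop :=
  match u, v with inl x, inr y | inr x, inl y => x = y | _, _ => False end.

Lemma one_edge_sym u v : one_edge u v -> one_edge v u.
Proof. by case: u v => [x|x] [y|y]. Qed.

Lemma one_edge_irrefl u : ~ one_edge u u.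
Proof. by case: u => x /=. Qed.

Lemma one_edge_deg1 u v w : one_edge u v -> one_edge u w -> v = w.
Proof. by case: u v w => [x|x] [y|y] [z|z] //= -> ->. Qed.

Definition onePB : PB X :=
  BrauerGraph one_edge_sym one_edge_irrefl one_edge_deg1.

Lemma mul1PB : left_id onePB mulPB.
Proof.
move=> a; apply: PB_eq => u v; split=> [[uv]|auv].
  pose r (w : (X + X) + X) : X + X :=
    match w with inl s => s | inr x => inl x end.
  suff H s t : connected (product_graph onePB a) s t ->
      r s = r t \/ edge a (r s) (r t).
    by move/H => /= [].
  elim=> {s t} [s t [[p [q [/= pq -> ->]]]|[p [q [/= pq -> ->]]]]
               |s|s t _ [->|/edge_sym]|s t w _ IH1 _ IH2]; do ?by [left|right].
  - by left; case: p q pq => [x|x] [y|y] //= ->.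
  - by right; case: p q pq => [x|x] [y|y].
  - case: IH1 IH2 => [->//|st] [<-|tw]; first by right.
    by left; apply: edge_deg1 tw; apply: edge_sym.
split; first by move=> uv; apply: (@edge_irrefl _ a v); rewrite {1}uv in auv.
have down w : connected (product_graph onePB a) (inl w) (upper_to_mid w).
  case: w => x; last exact: rst_refl.
  by apply: rst_step; left; exists (inl x), (inr x).
apply: rst_trans (down u) _; apply: rst_trans (rst_sym _ _ _ _ (down v)).
by apply: rst_step; right; exists u, v.
Qed.

Lemma mulPB1 : right_id onePB mulPB.
Proof.
move=> a; apply: PB_eq => u v; split=> [[uv]|auv].
  pose r (w : (X + X) + X) : X + X :=
    match w with inl s => s | inr x => inr x end.
  suff H s t : connected (product_graph a onePB) s t ->
      r s = r t \/ edge a (r s) (r t).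
    by move/H => /= [].
  elim=> {s t} [s t [[p [q [/= pq -> ->]]]|[p [q [/= pq -> ->]]]]
               |s|s t _ [->|/edge_sym]|s t w _ IH1 _ IH2]; do ?by [left|right].
  - by right; case: p q pq => [x|x] [y|y].
  - by left; case: p q pq => [x|x] [y|y] //= ->.
  - case: IH1 IH2 => [->//|st] [<-|tw]; first by right.
    by left; apply: edge_deg1 tw; apply: edge_sym.
split; first by move=> uv; apply: (@edge_irrefl _ a v); rewrite {1}uv in auv.
have up w : connected (product_graph a onePB) (inl w) (lower_to_mid w).
  case: w => x; first exact: rst_refl.
  by apply: rst_step; right; exists (inr x), (inl x).
apply: rst_trans (up u) _; apply: rst_trans (rst_sym _ _ _ _ (up v)).
by apply: rst_step; left; exists u, v.
Qed.

(* Both bracketings in [mulPBA] are computed in the four-layer graph of a, b and c *)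
Let V4 := ((X + X) + (X + X))%type.
Let layer (f g : X -> V4) (v : X + X) : V4 :=
  match v with inl x => f x | inr x => g x end.
Let l0 (x : X) : V4 := inl (inl x).
Let l1 (x : X) : V4 := inr (inl x).
Let l2 (x : X) : V4 := inr (inr x).
Let l3 (x : X) : V4 := inl (inr x).

Let layer3 (f g h : X -> V4) (v : (X + X) + X) : V4 :=
  match v with inl (inl x) => f x | inl (inr x) => g x | inr x => h x end.

Let shortcut_mul (f g h : X -> V4) a b : injective (layer3 f g h) ->
  shortcut (fun u => exists x, u = h x)
    (edgeU (relabel (layer f h) (edge a)) (relabel (layer h g) (edge b)))
  = relabel (layer f g) (mul_edge a b).
Proof.
move=> kinj.
have -> : edgeU (relabel (layer f h) (edge a)) (relabel (layer h g) (edge b))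
    = relabel (layer3 f g h) (product_graph a b).
  rewrite /product_graph relabelU !relabel_comp.
  have -> : layer3 f g h \o lower_to_mid = layer f h by apply/funext => -[].
  by have -> : layer3 f g h \o upper_to_mid = layer h g by apply/funext => -[].
have kE s : layer3 f g h (inl s) = layer f g s by case: s.
apply/funext => u; apply/funext => v; apply/propext; split.
- case=> Mu Mv uv /(connected_relabel _ kinj)[//|[[s|x] [[t|y] [H us vt]]]].
  + exists s, t; rewrite us vt !kE; split=> //; split=> // st.
    by apply: uv; rewrite us vt st.
  + by case: Mv; exists y.
  + by case: Mu; exists x.
  + by case: Mu; exists x.
- case=> s [t [[st H] -> ->]]; rewrite -!kE; split.
  + by case=> x /(kinj _ (inr x)).
  + by case=> x /(kinj _ (inr x)).
  + by move/kinj => -[].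
  + exact/connected_relabelE.
Qed.

Lemma mulPBA : associative mulPB.
Proof.
move=> a b c; apply: PB_eq => u v /=.
pose P := edgeU (relabel (layer l0 l1) (edge a))
  (edgeU (relabel (layer l1 l2) (edge b)) (relabel (layer l2 l3) (edge c))).
have inj312 : injective (layer3 l1 l3 l2) by move=> [[x|x]|x] [[y|y]|y] //= [->].
have inj021 : injective (layer3 l0 l2 l1) by move=> [[x|x]|x] [[y|y]|y] //= [->].
have inj031 : injective (layer3 l0 l3 l1) by move=> [[x|x]|x] [[y|y]|y] //= [->].
have inj032 : injective (layer3 l0 l3 l2) by move=> [[x|x]|x] [[y|y]|y] //= [->].
suff [HL HR] : (mul_edge a (mulPB b c) u v <->
                  u <> v /\ connected P (inl u) (inl v)) /\
               (mul_edge (mulPB a b) c u v <->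
                  u <> v /\ connected P (inl u) (inl v)).
  by split=> [/HL/HR|/HR/HL].
have E031 w : layer3 l0 l3 l1 (inl w) = inl w by case: w.
have E032 w : layer3 l0 l3 l2 (inl w) = inl w by case: w.
have outer2 w : ~ exists x, inl w = l2 x by case.
have outer1 w : ~ exists x, inl w = l1 x by case.
split; rewrite /mul_edge.
- rewrite -(connected_relabelE _ inj031) !E031.
  have -> : relabel (layer3 l0 l3 l1) (product_graph a (mulPB b c)) =
      edgeU (relabel (layer l1 l3) (mul_edge b c))
            (relabel (layer l0 l1) (edge a)).
    rewrite /product_graph relabelU !relabel_comp.
    have -> : layer3 l0 l3 l1 \o lower_to_mid = layer l0 l1.
      by apply/funext => -[].
    have -> : layer3 l0 l3 l1 \o upper_to_mid = layer l1 l3.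
      by apply/funext => -[].
    by apply/funext => s; apply/funext => t; apply/propext; rewrite /edgeU; tauto.
  rewrite -(shortcut_mul _ _ inj312) connected_shortcut //; last first.
    move=> s t [p [q [_ -> ->]]].
    by split; [case: p|case: q] => x [].
  have -> // : edgeU (edgeU (relabel (layer l1 l2) (edge b))
      (relabel (layer l2 l3) (edge c))) (relabel (layer l0 l1) (edge a)) = P.
  by apply/funext => s; apply/funext => t; apply/propext; split;
     rewrite /P /edgeU; tauto.
- rewrite -(connected_relabelE _ inj032) !E032.
  have -> : relabel (layer3 l0 l3 l2) (product_graph (mulPB a b) c) =
      edgeU (relabel (layer l0 l2) (mul_edge a b))
            (relabel (layer l2 l3) (edge c)).
    rewrite /product_graph relabelU !relabel_comp.
    have -> : layer3 l0 l3 l2 \o lower_to_mid = layer l0 l2.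
      by apply/funext => -[].
    by have -> : layer3 l0 l3 l2 \o upper_to_mid = layer l2 l3
      by apply/funext => -[].
  rewrite -(shortcut_mul _ _ inj021) connected_shortcut //; last first.
    move=> s t [p [q [_ -> ->]]].
    by split; [case: p|case: q] => x [].
  have -> // : edgeU (edgeU (relabel (layer l0 l1) (edge a))
      (relabel (layer l1 l2) (edge b))) (relabel (layer l2 l3) (edge c)) = P.
  by apply/funext => s; apply/funext => t; apply/propext; split;
     rewrite /P /edgeU; tauto.
Qed.

End Product.

HB.instance Definition _ (X : Type) :=
  isMonoid.Build (PB X) (@mulPBA X) (@mul1PB X) (@mulPB1 X).

(* The empty set is allowed, so that the empty set generates itself *)
Definition subsemigroup (S : semigroupType) (A : set S) : Prop :=
  forall x y, A x -> A y -> A (x * y).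

Definition generated (S : semigroupType) (U : set S) : set S :=
  smallest (@subsemigroup S) U.

(* rank(T : A) = |K|, for a subsemigroup T of S and a subset A of T:
   |K| is the least cardinality of a U completing A to a generating set of T *)
Definition relative_rank_eq (S : semigroupType) (T A : set S)
    (J : Type) (K : set J) : Prop :=
  (exists U : set S, [/\ U `<=` T, T = generated (A `|` U) & U #= K]) /\
  (forall U : set S, U `<=` T -> T = generated (A `|` U) -> K #<= U).

Definition idempotents (S : semigroupType) : set S := [set x | x * x = x].
Arguments idempotents S : clear implicits.

Definition units (M : monoidType) : set M :=
  [set x | exists y, x * y = 1 /\ y * x = 1].
Arguments units M : clear implicits.

Definition G_ (X : Type) : set (PB X) := units (PB X).
Arguments G_ X : clear implicits.

Definition E_ (X : Type) : set (PB X) := generated (idempotents (PB X)).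
Arguments E_ X : clear implicits.

Definition F_ (X : Type) : set (PB X) :=
  generated (idempotents (PB X) `|` units (PB X)).
Arguments F_ X : clear implicits.

(* Main.v *)
Require Import Defs.
From Stdlib Require Import Relation_Operators.
From mathcomp Require Import all_boot.
From mathcomp Require Import boolp classical_sets functions cardinality.

Set Implicit Arguments.
Unset Strict Implicit.
Unset Printing Implicit Defensive.

(** Part (ii) is a fact about arbitrary monoids with a non-trivial unit.  Let M
be a monoid, F its submonoid generated by idempotents and units.  If x is an
idempotent or a unit and x y is a unit, then x is a unit: an idempotent with a
right inverse is 1.  Cancelling the leading factor repeatedly, every factor of
a product of elements of F which happens to be a unit is itself a unit
([unit_factors]).  In particular the only unit that is a product of idempotents
is 1.  So if E and Omega together generate F, writing a unit as a product over
them and dropping the trivial factors expresses it through the units in Omega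
([generating_units], [F_generated_iff]).

For part (i), the group of units completes E to a generating set of F, and it
has cardinality 2^|X|.  It is that large because X contains |X| disjoint
two-element sets, and for any set of these there is an involution exchanging
the points of exactly the chosen ones ([card_units_ge]); it is no larger since
a graph is a set of pairs of vertices ([card_PB_le]).  Conversely, if E and U
generate F then, by part (ii), the units in U generate the whole group of
units, so there are at least 2^|X| finite sequences of them.  A finite set has
only countably many finite sequences, fewer than 2^|X|; an infinite one has as
many finite sequences as elements, hence there are at least 2^|X| units in U
([card_generating_units]).

The last step needs |T x T| = |T| for every infinite T, which is obtained from
Zorn's lemma in the classical way ([card_leX_infinite]). *)

Local Open Scope classical_set_scope.
Local Open Scope card_scope.
Local Open Scope group_scope.

(** * Comparing cardinals by functions and relations *)

Lemma card_le_injP T U (A : set T) (B : set U) :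
  A #<= B <-> exists f : A -> B, injective f.
Proof.
split=> [/card_leP/injfunPex[f _ finj]|[f finj]].
  by exists f => a a'; apply: finj; rewrite inE.
by apply/card_leP/injfunPex; exists f => // a a' _ _ /finj.
Qed.

Lemma card_leT_injP T U : [set: T] #<= [set: U] <-> exists f : T -> U, injective f.
Proof.
split=> [/card_le_injP[f finj]|[f finj]].
  exists (fun x => set_val (f (SigSub (mem_set (I : [set: T] x))))) => x y.
  by move/val_inj/finj/(congr1 set_val).
apply/card_le_injP; exists (fun x => SigSub (mem_set (I : [set: U] (f (set_val x))))).
by move=> x y /(congr1 set_val)/finj/val_inj.
Qed.

(** A relation, unlike a function on the whole type, needs no default value
outside A and no choice of images. *)
Lemma card_le_rel T U (A : set T) (B : set U) (R : T -> U -> Prop) :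
  (forall x, A x -> exists2 y, B y & R x y) ->
  (forall x x' y, A x -> A x' -> R x y -> R x' y -> x = x') ->
  A #<= B.
Proof.
move=> Rtot Rinj.
have {}Rtot (a : A) : exists b : B, R (set_val a) (set_val b).
  have [y By Ry] := Rtot _ (set_valP a).
  by exists (SigSub (mem_set By)).
have [f Rf] := choice Rtot.
apply/card_le_injP; exists f => a a' faa'; apply: val_inj.
apply: Rinj (Rf a) _; try exact: set_valP.
by rewrite faa'; apply: Rf.
Qed.

Lemma card_le_fun T U (u0 : U) (A : set T) (B : set U) : A #<= B ->
  exists f : T -> U, (forall x, A x -> B (f x)) /\
    (forall x y, A x -> A y -> f x = f y -> x = y).
Proof.
move=> /card_le_injP[f finj].
exists (fun x => if pselect (A x) is left Ax then set_val (f (SigSub (mem_set Ax)))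
                 else u0).
split=> [x Ax|x y Ax Ay]; case: pselect => // {}Ax; first exact: set_valP.
by case: pselect => // {}Ay /val_inj/finj/(congr1 set_val).
Qed.

(** Comparability of cardinals: a maximal graph of a partial injection from A
to B, which exists by Zorn's lemma, must exhaust A or B, since otherwise one
more pair could be added. *)
Lemma card_le_total T U (A : set T) (B : set U) : A #<= B \/ B #<= A.
Proof.
pose P (R : set (T * U)) :=
  [/\ forall p, R p -> A p.1 /\ B p.2,
      forall x y y', R (x, y) -> R (x, y') -> y = y' &
      forall x x' y, R (x, y) -> R (x', y) -> x = x'].
have [F FP Fchain|R [[RAB Rfun Rinj] Rmax]] := @Zorn_bigcup _ P.
  have joint p q : (\bigcup_(R in F) R) p -> (\bigcup_(R in F) R) q ->
      exists R, [/\ F R, R p & R q].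
    move=> [R FR Rp] [S FS Sq].
    by case: (Fchain _ _ FR FS) => RS; [exists S|exists R]; split=> //; apply: RS.
  split=> [p [R FR Rp]|x y y' /joint H /H[R [FR Rp Rq]]
          |x x' y /joint H /H[R [FR Rp Rq]]].
  - by have [RAB _ _] := FP _ FR; apply: RAB.
  - by have [_ Rfun _] := FP _ FR; apply: Rfun Rp Rq.
  - by have [_ _ Rinj] := FP _ FR; apply: Rinj Rp Rq.
(* R injects A into B or the reverse, unless x in A and y in B are both unmatched *)
have [Rdom|/existsNP[x /not_implyP[Ax Rx]]] :=
    pselect (forall x, A x -> exists2 y, B y & R (x, y)).
  by left; apply: card_le_rel Rdom _ => x x' y _ _; apply: Rinj.
have [Rran|/existsNP[y /not_implyP[By Ry]]] :=
    pselect (forall y, B y -> exists2 x, A x & R (x, y)).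
  right; apply: (@card_le_rel _ _ _ _ (fun y x => R (x, y)) Rran).
  by move=> y y' z _ _; apply: Rfun.
have {}Rx y' : ~ R (x, y') by move=> H; apply: Rx; exists y' => //; case: (RAB _ H).
have {}Ry x' : ~ R (x', y) by move=> H; apply: Ry; exists x' => //; case: (RAB _ H).
case: (Rmax (R `|` [set (x, y)])).
  by split=> [p|/(_ (x, y))]; [left|move=> H; apply: (Rx y); apply: H; right].
split=> [p|x' y1 y2|x1 x2 y'].
- by case=> [/RAB//|->].
- move=> [H1|[e1 e1']] [H2|[e2 e2']]; subst=> //; first exact: Rfun H1 H2.
  + by case: (Rx _ H1).
  + by case: (Rx _ H2).
- move=> [H1|[e1 e1']] [H2|[e2 e2']]; subst=> //; first exact: Rinj H1 H2.
  + by case: (Ry _ H1).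
  + by case: (Ry _ H2).
Qed.

Lemma Cantor_setT T : ~ ([set: set T] #<= [set: T]).
Proof.
move/card_leT_injP => [f finj].
pose D : set T := [set x | exists2 A, f A = x & ~ A x].
have DD : ~ D (f D) by move=> H; case: (H) => A /finj-> ; apply.
by apply: (DD); exists D.
Qed.

Lemma infinite_inj_nat T :
  infinite_set [set: T] -> exists nu : nat -> T, injective nu.
Proof. by move/infiniteP/card_leT_injP. Qed.

(** * Squares and finite sequences of infinite sets *)

(** Among the injections from D x D to D, for D a subset of T, that extend a
fixed one R0 on a countably infinite set, take a maximal one.  If the complement
of D embeds in D, then T embeds in D, and so T x T embeds in D x D, hence in D.
Otherwise D has a copy D' disjoint from it, and the injection extends to
D u D': the new pairs form three copies of D x D, and D' has room for them.
This contradicts maximality.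

Injections are represented by their graphs R, so that a chain has its union as
upper bound; D is recovered from R as the set of x such that (x, x) has an
image. *)
Lemma card_leX_infinite T : infinite_set [set: T] ->
  [set: T * T] #<= [set: T].
Proof.
move=> /infinite_inj_nat[nu nu_inj].
pose dom (R : set ((T * T) * T)) := [set x | exists z, R ((x, x), z)].
pose R0 : set ((T * T) * T) :=
  [set q | exists i j, q = ((nu i, nu j), nu (pickle (i, j)))].
(* The first clause says R is empty or extends R0: the union of the empty chain
   must satisfy P as well *)
pose P (R : set ((T * T) * T)) :=
  [/\ forall q, R q -> R0 `<=` R,
      forall x y z, R ((x, y), z) -> [/\ dom R x, dom R y & dom R z],
      forall x y, dom R x -> dom R y -> exists z, R ((x, y), z),
      forall p z z', R (p, z) -> R (p, z') -> z = z' &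
      forall p p' z, R (p, z) -> R (p', z) -> p = p'].
have dom_mono R S x : R `<=` S -> dom R x -> dom S x by move=> RS [z /RS Sz]; exists z.
have [F FP Fchain|R [[R0R Rdom Rtot Rfun Rinj] Rmax]] := @Zorn_bigcup _ P.
  have joint p q : (\bigcup_(R in F) R) p -> (\bigcup_(R in F) R) q ->
      exists R, [/\ F R, R p & R q].
    move=> [R FR Rp] [S FS Sq].
    by case: (Fchain _ _ FR FS) => RS; [exists S|exists R]; split=> //; apply: RS.
  split.
  - move=> q [R FR Rq] p R0p; exists R => //.
    by case: (FP _ FR) => /(_ _ Rq) + _ _ _ _; apply.
  - move=> x y z [R FR Rq]; have [_ /(_ _ _ _ Rq)[dx dy dz] _ _ _] := FP _ FR.
    by split; apply: (dom_mono R) => // p Rp; exists R.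
  - move=> x y [z dx] [z' dy]; have [R [FR Rx Ry]] := joint _ _ dx dy.
    have [_ _ Rtot _ _] := FP _ FR.
    have [||w Rw] := Rtot x y; [by exists z|by exists z'|].
    by exists w; exists R.
  - move=> p z z' /joint H /H[R [FR Rp Rq]].
    by have [_ _ _ Rfun _] := FP _ FR; apply: Rfun Rp Rq.
  - move=> p p' z /joint H /H[R [FR Rp Rq]].
    by have [_ _ _ _ Rinj] := FP _ FR; apply: Rinj Rp Rq.
have domR0 i : dom R0 (nu i) by exists (nu (pickle (i, i))), i, i.
have {R0R} R0R : R0 `<=` R.
  have [[q /R0R//]|R_empty] := pselect (exists q, R q).
  have nR q : ~ R q by move=> Rq; apply: R_empty; exists q.
  case: (Rmax R0).
    split=> [q /nR//|/(_ ((nu 0, nu 0), nu (pickle (0, 0))))H].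
    by apply: nR (H _); exists 0, 0.
  split.
  - by move=> q _ p.
  - by move=> x y z [i [j [-> -> ->]]]; split; apply: domR0.
  - move=> x y [_ [i [_ [-> _ _]]]] [_ [j [_ [-> _ _]]]].
    by exists (nu (pickle (i, j))), i, j.
  - by move=> p z z' [i [j [-> ->]]] [i' [j' [/nu_inj<- /nu_inj<- ->]]].
  - move=> p p' z [i [j [-> ->]]] [i' [j' [-> /nu_inj/(pcan_inj (@pickleK _))]]].
    by case=> -> ->.
pose D := dom R.
have Dnu i : D (nu i) by apply: dom_mono R0R _.
have [f Rf] : exists f : T * T -> T,
    forall p, D p.1 -> D p.2 -> R (p, f p).
  have H p : exists z, D p.1 -> D p.2 -> R (p, z).
    have [[D1 D2]|nD] := pselect (D p.1 /\ D p.2).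
      by have [z Rz] := Rtot _ _ D1 D2; exists z; case: p {D1 D2} Rz.
    by exists p.1 => D1 D2; case: nD.
  by have [f Hf] := choice H; exists f.
have Df x y : D x -> D y -> D (f (x, y)).
  by move=> Dx Dy; have [] := Rdom _ _ _ (Rf (x, y) Dx Dy).
have finj x y x' y' : D x -> D y -> D x' -> D y' ->
    f (x, y) = f (x', y') -> x = x' /\ y = y'.
  move=> Dx Dy Dx' Dy' e; have H := Rf (x, y) Dx Dy; rewrite e in H.
  by case: (Rinj _ _ _ H (Rf (x', y') Dx' Dy')).
have [/(card_le_fun (nu 0))[g [gD ginj]]|/(card_le_fun (nu 0))[g [gD ginj]]] :=
    card_le_total (~` D) D.
  (* h embeds T in D: the points nu 0 and nu 1 of D keep the images of D and of
     its complement apart *)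
  pose h x := if pselect (D x) then f (x, nu 0) else f (g x, nu 1%N).
  have Dh x : D (h x).
    by rewrite /h; case: pselect => Dx; apply: Df => //; apply: gD.
  have hinj : injective h.
    move=> x y; rewrite /h; case: pselect => Dx; case: pselect => Dy /finj[] //;
      do ?exact: gD; do ?by move=> _ /nu_inj.
    by move=> /(ginj _ _ Dx Dy).
  apply/card_leT_injP; exists (fun p => f (h p.1, h p.2)).
  by move=> [x y] [x' y'] /= /finj[] // /hinj-> /hinj->.
(* e true d is d itself and e false d its copy in D', the image of g *)
pose e (b : bool) d := if b then d else g d.
(* An injective code in D for the pair (e b d, e b' d') *)
pose code b b' d d' := f (f (d, d'), nu (pickle (b : bool, b' : bool))).
(* The pairs outside D x D are sent to the copies in D' of their codes *)
pose R' : set ((T * T) * T) := [set q | exists b b' d d',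
  [/\ D d, D d', ~~ (b && b') & q = ((e b d, e b' d'), g (code b b' d d'))]].
have Dcode b b' d d' : D d -> D d' -> D (code b b' d d').
  by move=> Dd Dd'; apply: (Df); [apply: Df|apply: Dnu].
have code_inj b b' d d' c c' h h' : D d -> D d' -> D h -> D h' ->
    code b b' d d' = code c c' h h' -> [/\ b = c, b' = c', d = h & d' = h'].
  move=> Dd Dd' Dh Dh' /finj[]; do ?exact: Df; do ?exact: Dnu.
  move=> /finj[] // -> -> /nu_inj/(pcan_inj (@pickleK _)).
  by case=> -> ->.
have einj b d c h : D d -> D h -> e b d = e c h -> b = c /\ d = h.
  case: b c => [] [] //= Dd Dh => [dh|dh|/ginj->//].
    by case: (gD h Dh); rewrite -dh.
  by case: (gD d Dd); rewrite dh.
have domE x : dom (R `|` R') x <-> exists b d, D d /\ x = e b d.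
  split=> [[z [Rz|[b [b' [d [d' [Dd Dd' _ [-> _ _]]]]]]]]|[[] [d [Dd ->]]]].
  - by exists true, x; split=> //; exists z.
  - by exists b, d.
  - by apply: dom_mono Dd; left.
  - by exists (g (code false false d d)); right; exists false, false, d, d.
(* The graphs R and R' have disjoint domains and disjoint ranges *)
have RR' p z z' : R (p, z) -> ~ R' (p, z').
  move=> Rz [b [b' [d [d' [Dd Dd' nb [pE _]]]]]]; rewrite pE in Rz.
  have [De De' _] := Rdom _ _ _ Rz.
  by case: b b' De De' nb {pE Rz} => -[] //= De De' _;
     [case: (gD d')|case: (gD d)|case: (gD d)].
have RR'_ran p p' z : R (p, z) -> ~ R' (p', z).
  case: p => x y Rz [b [b' [d [d' [Dd Dd' nb [_ zE]]]]]].
  have [_ _ Dz] := Rdom _ _ _ Rz.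
  by case: (gD (code b b' d d')); [apply: Dcode|rewrite -zE].
case: (Rmax (R `|` R')).
  split=> [p|]; first by left.
  pose a := e false (nu 0).
  move=> /(_ ((a, a), g (code false false (nu 0) (nu 0)))) H.
  have Q : R' ((a, a), g (code false false (nu 0) (nu 0))).
    by exists false, false, (nu 0), (nu 0).
  by apply: (RR' _ _ _ (H (or_intror Q)) Q).
split.
- by move=> _ _ q /R0R; left.
- move=> x y z [/Rdom[Dx Dy Dz]|[b [b' [d [d' [Dd Dd' _ [-> -> ->]]]]]]].
    by split; apply: (dom_mono R) => // p Rp; left.
  split; apply/domE; [by exists b, d|by exists b', d'|].
  by exists false, (code b b' d d'); split=> //; apply: Dcode.
- move=> x y /domE[b [d [Dd ->]]] /domE[b' [d' [Dd' ->]]].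
  have [bb|nbb] := boolP (b && b').
    by exists (f (d, d')); left; case/andP: bb => -> -> /=; apply: Rf.
  by exists (g (code b b' d d')); right; exists b, b', d, d'.
- move=> p z z' [H|H] [K|K].
  + exact: Rfun H K.
  + by case: (RR' _ _ _ H K).
  + by case: (RR' _ _ _ K H).
  + case: H K => [b [b' [d [d' [Dd Dd' _ [-> ->]]]]]].
    case=> c [c' [h [h' [Dh Dh' _ [E1 E2 ->]]]]].
    have [-> ->] := einj _ _ _ _ Dd Dh E1.
    by have [-> ->] := einj _ _ _ _ Dd' Dh' E2.
- move=> p p' z [H|H] [K|K].
  + exact: Rinj H K.
  + by case: (RR'_ran _ _ _ H K).
  + by case: (RR'_ran _ _ _ K H).
  + case: H K => [b [b' [d [d' [Dd Dd' _ [-> ->]]]]]].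
    case=> c [c' [h [h' [Dh Dh' _ [-> E]]]]].
    by case/ginj/code_inj: E => // [||->->->->//]; apply: Dcode.
Qed.

(** Folding an injection p of T x T into T codes each sequence injectively among
those of its length, and a last use of p records the length. *)
Lemma card_le_seq T : infinite_set [set: T] -> [set: seq T] #<= [set: T].
Proof.
move=> infT; have [nu nu_inj] := infinite_inj_nat infT.
have /card_leT_injP[p p_inj] := card_leX_infinite infT.
pose code := foldr (fun x a => p (x, a)) (nu 0).
apply/card_leT_injP; exists (fun s => p (nu (size s), code s)).
move=> s t /p_inj[/nu_inj]; elim: s t => [|x s IH] [|y t] //= [].
by move=> /IH{}IH /p_inj[-> /IH->].
Qed.
(** * Generated subsemigroups *)

Section Generation.
Variable S : semigroupType.
Implicit Types U V A : set S.

Lemma generated_subsemigroup U : subsemigroup (generated U).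
Proof.
by move=> x y Ux Uy A AU; apply: AU.1; [exact: Ux|exact: Uy].
Qed.

Lemma generated_mono U V : U `<=` V -> generated U `<=` generated V.
Proof. exact: sub_smallest2r (@generated_subsemigroup V). Qed.
End Generation.

Lemma card_le_generated (M : monoidType) (V : set M) :
  generated V #<= [set: seq V].
Proof.
pose prod (s : seq V) := foldr (fun (v : V) m => set_val v * m) 1 s.
apply: (@card_le_rel _ _ _ _ (fun m s => m = prod s)) => [m|m m' s _ _ -> ->//].
suff H : generated V `<=` [set m | exists s, m = prod s].
  by move=> /H[s ->]; exists s.
apply: smallest_sub => [_ _ [s ->] [t ->]|v Vv].
  exists (s ++ t); elim: s => [|v s IH] /=; first exact: mul1g.
  by rewrite -mulgA IH.
by exists [:: SigSub (mem_set Vv)]; rewrite /= mulg1.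
Qed.

(** * Units among products of idempotents and units *)

Section UnitsAndIdempotents.
Variable M : monoidType.
Implicit Types x y : M.
Let E := generated (idempotents M).
Let F := generated (idempotents M `|` units M).

Lemma units_subsemigroup : subsemigroup (units M).
Proof.
move=> x y [x' [xx' x'x]] [y' [yy' y'y]]; exists (y' * x'); split.
  by rewrite mulgA -(mulgA x) yy' mulg1.
by rewrite mulgA -(mulgA y') x'x mulg1.
Qed.

Lemma unit_cancel x y : units M x -> units M (x * y) -> units M y.
Proof.
move=> [x' [xx' x'x]] xy; rewrite -(mul1g y) -x'x -mulgA.
by apply: units_subsemigroup xy; exists x.
Qed.

Lemma idempotent_unit x : idempotents M x -> units M x -> x = 1.
Proof. by move=> xx [y [xy _]]; rewrite -xy -{2}xx -mulgA xy mulg1. Qed.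

(** In general x y can be a unit with neither factor a unit, so x in F is
essential: for x an idempotent or a unit, right invertibility already makes x a
unit, and this passes to products. *)
Lemma unit_factors x y : F x -> units M (x * y) -> units M x /\ units M y.
Proof.
move=> Fx xy; suff ux : units M x by split=> //; apply: unit_cancel xy.
suff H : F `<=` [set x | forall y, units M (x * y) -> units M x] by apply: H xy.
apply: smallest_sub => [{x y Fx xy} a b Ha Hb y|e [ee|ue] z ez //].
  rewrite -mulgA => aby; have ua := Ha _ aby.
  by apply: units_subsemigroup => //; apply: Hb (unit_cancel ua aby).
suff -> : e = 1 by exists 1; rewrite mul1g.
have [z' [ezz' _]] := ez.
(* e = e (e z z') = (e z) z' = 1 *)
have : e * (e * z * z') = e * z * z' by rewrite !mulgA ee.
by rewrite ezz' mulg1.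
Qed.

Lemma E_sub_F : E `<=` F.
Proof. by apply: generated_mono; left. Qed.

Lemma E_unit x : E x -> units M x -> x = 1.
Proof.
suff H : E `<=` [set x | F x /\ (units M x -> x = 1)] by case/H.
apply: smallest_sub => [{x} x y [Fx x1] [Fy y1]|e ee]; last first.
  by split; [apply: sub_gen_smallest; left|apply: idempotent_unit].
split; first exact: generated_subsemigroup.
by case/(unit_factors Fx) => /x1-> /y1->; rewrite mul1g.
Qed.

(** All factors of a unit in F are units; those from E are 1 and disappear.  The
alternative x = 1 covers products in which no other factor occurs. *)
Lemma generating_units (Omega : set M) : Omega `<=` F ->
  F = generated (E `|` Omega) ->
  forall x, units M x -> x = 1 \/ generated (units M `&` Omega) x.
Proof.
move=> OF Fgen x ux.
suff H : F `<=` [set x | F x /\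
    (units M x -> x = 1 \/ generated (units M `&` Omega) x)].
  by case: (H x) => [|_]; [apply: sub_gen_smallest; right|apply].
rewrite {1}Fgen; apply: smallest_sub => [{x ux} x y [Fx Hx] [Fy Hy]|{ux} {}x].
  split; first exact: generated_subsemigroup.
  case/(unit_factors Fx) => /Hx[->|gx] /Hy[->|gy]; rewrite ?mul1g ?mulg1; auto.
  by right; apply: generated_subsemigroup.
case=> [Ex|Ox]; first by split; [exact: E_sub_F|left; exact: E_unit].
by split=> [|ux]; [exact: OF|right; exact: sub_gen_smallest].
Qed.

Lemma generated_E_units : F = generated (E `|` units M).
Proof.
apply/seteqP; split.
  by apply: generated_mono => x [ix|]; [left; exact: sub_gen_smallest|right].
apply: smallest_sub; first exact: generated_subsemigroup.
by move=> x [/E_sub_F//|ux]; apply: sub_gen_smallest; right.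
Qed.

(** The non-trivial unit u serves to obtain 1 itself, as the product of u and
its inverse, from the units in Omega. *)
Lemma F_generated_iff (Omega : set M) (u : M) : units M u -> u <> 1 ->
  Omega `<=` F ->
  F = generated (E `|` Omega) <-> units M = generated (units M `&` Omega).
Proof.
move=> [v [uv vu]] u1 OF; split=> [Fgen|Ggen].
  have gen := generating_units OF Fgen; apply/seteqP; split=> [x ux|]; last first.
    by apply: smallest_sub units_subsemigroup _ => x [].
  case: (gen _ ux) => // ->; rewrite -uv.
  apply: generated_subsemigroup.
    by case: (gen u) => //; exists v.
  case: (gen v) => //; first by exists u.
  by move=> v1; case: u1; rewrite -uv v1 mulg1.
apply/seteqP; split.
  rewrite {1}generated_E_units; apply: smallest_sub => [|x [Ex|]].
  - exact: generated_subsemigroup.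
  - by apply: sub_gen_smallest; left.
  - by rewrite Ggen; apply: generated_mono => y []; right.
apply: smallest_sub; first exact: generated_subsemigroup.
by move=> x [/E_sub_F|/OF].
Qed.

End UnitsAndIdempotents.

(** * Units given by involutions of X *)

Section InvolutionUnits.
Variable X : Type.

Definition invol_edge (f : X -> X) (u v : X + X) : Prop :=
  match u, v with inl x, inr y | inr y, inl x => f x = y | _, _ => False end.

Lemma invol_edge_sym f u v : invol_edge f u v -> invol_edge f v u.
Proof. by case: u v => [x|x] [y|y]. Qed.

Lemma invol_edge_irrefl f u : ~ invol_edge f u u.
Proof. by case: u => x /=. Qed.

Lemma invol_edge_deg1 f : involutive f ->
  forall u v w, invol_edge f u v -> invol_edge f u w -> v = w.
Proof.
move=> fK [x|x] [y|y] [z|z] //= => [<- <-//|].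
by move=> <- /(can_inj fK)->.
Qed.

Definition involPB f (fK : involutive f) : PB X :=
  BrauerGraph (@invol_edge_sym f) (@invol_edge_irrefl f) (invol_edge_deg1 fK).

Lemma involPB_sqr f (fK : involutive f) : involPB fK * involPB fK = 1.
Proof.
apply: PB_eq => u v; split=> [[uv]|].
  (* r is constant on the components of the product graph *)
  pose r (w : (X + X) + X) : X :=
    match w with inl (inl x) | inl (inr x) => x | inr x => f x end.
  suff H s t : connected (product_graph (involPB fK) (involPB fK)) s t -> r s = r t.
    by move/H; case: u v uv => [x|x] [y|y] //= uv xy; rewrite xy in uv.
  elim=> {s t} [s t|//|s t _ -> //|s t w _ -> _ -> //].
  case=> -[[x|x] [[y|y] [/= e -> -> //=]]]; rewrite -?e ?fK //.
have H x : connected (product_graph (involPB fK) (involPB fK))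
    (inl (inl x)) (inl (inr x)).
  apply: (rst_trans _ _ _ (inr (f x))); apply: rst_step.
    by left; exists (inl x), (inr (f x)).
  by right; exists (inl (f x)), (inr x); rewrite /= fK.
by case: u v => [x|x] [y|y] //= ->; split=> //; apply: rst_sym; exact: H.
Qed.

Lemma involPB_unit f (fK : involutive f) : G_ X (involPB fK).
Proof. by exists (involPB fK); rewrite involPB_sqr. Qed.

End InvolutionUnits.


(** * The number of units *)

Lemma card_leU_infinite X : infinite_set [set: X] -> [set: X + X] #<= [set: X].
Proof.
move=> infX.
have [nu nu_inj] := infinite_inj_nat infX.
have /card_leT_injP[p p_inj] := card_leX_infinite infX.
apply/card_leT_injP.
exists (fun v => match v with inl x => p (x, nu 0) | inr x => p (x, nu 1%N) end).
by move=> [x|x] [y|y] /p_inj[-> // /nu_inj].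
Qed.

Lemma card_PB_le X : infinite_set [set: X] -> [set: PB X] #<= [set: set X].
Proof.
move=> infX.
have /card_leT_injP[i i_inj] := card_leU_infinite infX.
have /card_leT_injP[p p_inj] := card_leX_infinite infX.
apply/card_leT_injP.
exists (fun a : PB X => [set x | exists u v, edge a u v /\ x = p (i u, i v)]).
suff H (a b : PB X) : [set x | exists u v, edge a u v /\ x = p (i u, i v)] `<=`
    [set x | exists u v, edge b u v /\ x = p (i u, i v)] ->
    forall u v, edge a u v -> edge b u v.
  by move=> a b ab; apply: PB_eq => u v; split; apply: H; rewrite ab.
move=> ab u v auv; have [|u' [v' [buv]]] := ab (p (i u, i v)); first by exists u, v.
by move=> /p_inj[/i_inj-> /i_inj->].
Qed.

(** Given an injection j of X + X into X, a subset A of X is coded by the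
involution that exchanges the two images of x under j for each x in A and fixes
all other points. *)
Lemma card_units_ge X : infinite_set [set: X] -> [set: set X] #<= G_ X.
Proof.
move=> infX.
have /card_leT_injP[j j_inj] := card_leU_infinite infX.
pose flip (v : X + X) := match v with inl x => inr x | inr x => inl x end.
pose base (v : X + X) := match v with inl x => x | inr x => x end.
(* The graph of the involution coding A *)
pose R (A : set X) (x y : X) :=
  (exists v, [/\ A (base v), x = j v & y = j (flip v)]) \/
  (x = y /\ ~ exists v, A (base v) /\ x = j v).
have Rtot A x : exists y, R A x y.
  have [[v [Av ->]]|nv] := pselect (exists v, A (base v) /\ x = j v).
    by exists (j (flip v)); left; exists v.
  by exists x; right.
pose f A := projT1 (choice (Rtot A)).
have Rf A x : R A x (f A x) by rewrite /f; case: (choice _).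
have fE A v : A (base v) -> f A (j v) = j (flip v).
  move=> Av; case: (Rf A (j v)) => [[w [_ /j_inj<- ->//]]|[_ []]].
  by exists v.
have fK A : involutive (f A).
  move=> x; case: (Rf A x) => [[v [Av -> ->]]|[e _]]; last by rewrite -!e.
  by rewrite fE; case: v Av.
apply: (@card_le_rel _ _ _ _ (fun A g => g = involPB (fK A))).
  by move=> A _; exists (involPB (fK A)) => //; apply: involPB_unit.
move=> A B g _ _ -> eAB.
have {eAB} fAB x : f A x = f B x.
  have : edge (involPB (fK A)) (inl x) (inr (f A x)) by [].
  by rewrite eAB.
suff H C x : C x <-> f C (j (inl x)) = j (inr x).
  by apply/seteqP; split=> x /H; rewrite ?fAB => ?; apply/H; rewrite ?fAB.
split=> [Cx|e]; first exact: fE.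
case: (Rf C (j (inl x))) => [[v [Cv /j_inj vE _]]|[]]; first by rewrite -vE in Cv.
by rewrite e => /j_inj.
Qed.

(** The group of units is a surjective image of the set of finite sequences over
V.  If V is finite these are countably many, which Cantor's theorem forbids;
otherwise they are as many as the elements of V. *)
Lemma card_generating_units (X : Type) (infX : infinite_set [set: X])
  (V : set (PB X)) : G_ X = generated V -> [set: set X] #<= V.
Proof.
move=> GV.
have leV : [set: set X] #<= [set: seq V].
  by apply: card_le_trans (card_units_ge infX) _; rewrite GV; apply: card_le_generated.
have [finV|infV] := pselect (finite_set V); last first.
  apply: card_le_trans leV _; apply: card_le_trans (card_le_seq _) _.
    by move=> fV; apply: infV; rewrite -(eq_finite_set (card_setT V)).
  by have /card_eqPle[] := card_setT V.
have /card_le_injP[k k_inj] : V #<= [set: nat] by apply: finite_set_countable.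
case: (@Cantor_setT X); apply: card_le_trans leV _.
have [nu nu_inj] := infinite_inj_nat infX.
apply/card_leT_injP.
exists (fun s : seq V => nu (pickle (map (fun v => set_val (k v)) s))).
move=> s t /nu_inj/(pcan_inj (@pickleK _)); apply: inj_map => v w.
by move/val_inj/k_inj.
Qed.

Theorem theorem6p5 (X : Type) (infX : infinite_set [set: X]) :
  relative_rank_eq (F_ X) (E_ X) [set: set X] /\
  (forall Omega : set (PB X), Omega `<=` F_ X ->
     (F_ X = generated (E_ X `|` Omega) <->
      G_ X = generated (G_ X `&` Omega))).
Proof.
(* A trivial group of units would be too small to contain a copy of set X *)
have [u Gu u1] : exists2 u, G_ X u & u <> 1.
  apply: contrapT => nu; apply: (@Cantor_setT X).
  apply: card_le_trans (card_units_ge infX) _.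
  have [n n_inj] := infinite_inj_nat infX.
  apply: (@card_le_rel _ _ _ _ (fun _ x => x = n 0)) => [g _|g h _ Gg Gh _ _].
    by exists (n 0).
  have G1 k : G_ X k -> k = 1 by move=> Gk; apply: contrapT => k1; apply: nu; exists k.
  by rewrite (G1 _ Gg) (G1 _ Gh).
have generated_iff Omega := F_generated_iff (Omega := Omega) Gu u1.
split=> //; split.
  exists (G_ X); split; first by move=> x Gx; apply: sub_gen_smallest; right.
  - exact: generated_E_units.
  - apply/card_eqPle; split; last exact: card_units_ge.
    by apply: card_le_trans (card_leT _) (card_PB_le infX).
move=> U UF /(generated_iff _ UF)/(card_generating_units infX) leU.
by apply: card_le_trans leU _; apply: subset_card_le => x [].
Qed.
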